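(* Let $(Y_n,\mathbf{X}_n)$, $n\in\mathbb{N}$, and $(Y,\mathbf{X})$ be random vectors, where $Y_n$ and $Y$ are non-degenerate real-valued random variables and $\mathbf{X}_n$, $\mathbf{X}$ are random vectors (of finite, possibly different, dimensions). Let $Y'$ be a conditionally independent copy of $Y$ relative to $\mathbf{X}$, and let $Y_n'$ be a conditionally independent copy of $Y_n$ relative to $\mathbf{X}_n$. If (i) $(Y_n,Y_n')\to (Y,Y')$ in distribution as $n\to\infty$, and (ii) $(F_{Y_n}\circ F_{Y_n}^{-1})(t)\to (F_Y\circ F_Y^{-1})(t)$ as $n\to\infty$ for Lebesgue-almost all $t\in(0,1)$, then $\lim_{n\to\infty}\xi(Y_n,\mathbf{X}_n)=\xi(Y,\mathbf{X})$.
   Context: For a non-degenerate real random variable $Y$ and a random vector $\mathbf{X}$, Chatterjee's rank correlation is $$\xi(Y,\mathbf{X}) := \frac{\int_{\mathbb{R}} \mathrm{Var}(P(Y\ge y\mid \mathbf{X}))\,\mathrm{d}P^{Y}(y)}{\int_{\mathbb{R}} \mathrm{Var}(\mathbf{1}_{\{Y\ge y\}})\,\mathrm{d}P^{Y}(y)},$$ where $P^Y$ is the distribution of $Y$. A random variable $Y'$ is a conditionally independent copy of $Y$ relative to $\mathbf{X}$ if the conditional distribution of $Y'$ given $\mathbf{X}=\mathbf{x}$ equals that of $Y$ given $\mathbf{X}=\mathbf{x}$ for $P^{\mathbf{X}}$-almost all $\mathbf{x}$, and $Y$ and $Y'$ are conditionally independent given $\mathbf{X}$. $F_Y$ denotes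 the distribution function of $Y$ and $F_Y^{-1}(t)=\inf\{y\in\mathbb{R}: F_Y(y)\ge t\}$, $t\in(0,1)$, its generalized inverse (quantile function). *)

(* Defs.v *)
From HB Require Import structures.
From mathcomp Require Import all_boot all_order all_algebra.
From mathcomp Require Import all_classical all_reals all_analysis.

Set Implicit Arguments.
Unset Strict Implicit.
Unset Printing Implicit Defensive.

Import Order.TTheory GRing.Theory Num.Theory.
Import numFieldNormedType.Exports.

Local Open Scope classical_set_scope.
Local Open Scope ring_scope.

Section conditioning.
Context {d d' : measure_display} {T : measurableType d} {S : measurableType d'}
  {R : realType} (P : probability T R).
Implicit Types (A : set T) (X : {RV P >-> S}) (Y : {RV P >-> R}).

(* [f] is a version of the factorized conditional probability
   x |-> P(A | X = x). *)
Definition is_cond_prob_at A X (f : S -> R) : Prop :=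
  (distribution P X).-integrable [set: S] (EFin \o f) /\
  forall B : set S, measurable B ->
    (\int[distribution P X]_(x in B) (f x)%:E = P (A `&` X @^-1` B))%E.

(* Some version is picked; it exists by [cond_prob_atP] below and is unique up
   to a null set of the distribution of X. *)
Definition cond_prob_at A X : S -> R :=
  xget (fun=> 0) [set f | is_cond_prob_at A X f].

(* P(A | X), as a random variable on T *)
Definition cond_prob A X : T -> R := fun w => cond_prob_at A X (X w).

Definition is_cond_distribution Y X (k : R.-pker S ~> R) : Prop :=
  forall B : set R, measurable B ->
    is_cond_prob_at (Y @^-1` B) X (fun x => fine (k x B)).

Definition same_cond_distribution Y Y' X : Prop :=
  exists k k' : R.-pker S ~> R,
    [/\ is_cond_distribution Y X k, is_cond_distribution Y' X k' &
        {ae distribution P X, forall x,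
          forall B : set R, measurable B -> k x B = k' x B}].

Definition cond_independent Y Y' X : Prop :=
  forall B B' : set R, measurable B -> measurable B' ->
    {ae P, forall w,
      cond_prob (Y @^-1` B `&` Y' @^-1` B') X w =
      cond_prob (Y @^-1` B) X w * cond_prob (Y' @^-1` B') X w}.

Definition cond_indep_copy Y Y' X : Prop :=
  same_cond_distribution Y Y' X /\ cond_independent Y Y' X.

Definition chatterjee_xi Y X : R :=
  fine (\int[distribution P Y]_y
          'V_P[cond_prob [set w | (y <= Y w)%R] X])%E /
  fine (\int[distribution P Y]_y
          'V_P[(\1_[set w | (y <= Y w)%R] : T -> R)])%E.

Section existence.
Variables (A : set T) (mA : measurable A) (X : {RV P >-> S}).

Let nu (B : set S) : \bar R := P (A `&` X @^-1` B).

Let nu_le B : measurable B -> (nu B <= distribution P X B)%E.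
Proof.
move=> mB; have mXB : measurable (X @^-1` B).
  by rewrite -[_ @^-1` _]setTI; exact: measurable_funPT.
by apply: le_measure; rewrite ?inE//; exact: measurableI.
Qed.

Let nu0 : nu set0 = 0%E.
Proof. by rewrite /nu preimage_set0 setI0 measure0. Qed.

Let nu_fin : fin_num_fun nu.
Proof.
move=> B mB; rewrite ge0_fin_numE ?measure_ge0//.
apply: (le_lt_trans (nu_le mB)).
by rewrite (le_lt_trans (probability_le1 _ mB))// ltry.
Qed.

Let nu_sigma : semi_sigma_additive nu.
Proof.
move=> F mF tF mUF; rewrite /nu preimage_bigcup setI_bigcupr.
apply: measure_semi_sigma_additive.
- move=> i; apply: measurableI => //.
  by rewrite -[_ @^-1` _]setTI; exact: measurable_funPT.
- apply/trivIsetP => i j _ _ ij.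
  move/trivIsetP : tF => /(_ i j Logic.I Logic.I ij) Fij.
  by rewrite setIACA -[X in _ `&` X]preimage_setI Fij preimage_set0 setI0.
- apply: bigcupT_measurable => i; apply: measurableI => //.
  by rewrite -[_ @^-1` _]setTI; exact: measurable_funPT.
Qed.

Let nu_dom : nu `<< distribution P X.
Proof.
apply/null_content_dominatesP => B mB B0.
by apply/eqP; rewrite eq_le measure_ge0 andbT -B0; exact: nu_le.
Qed.

Lemma cond_prob_atP : is_cond_prob_at A X (cond_prob_at A X).
Proof.
rewrite /cond_prob_at; set G := [set f | _].
suff : exists f, G f by case=> f Gf; exact: (xgetPex _ (ex_intro _ f Gf)).
pose c : {charge set S -> \bar R} :=
  HB.pack nu (isCharge.Build _ S R nu nu0 nu_fin nu_sigma).
have c_dom : c `<< distribution P X := nu_dom.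
exists (fine \o Radon_Nikodym c (distribution P X)).
have fE : EFin \o (fine \o Radon_Nikodym c (distribution P X)) =
          Radon_Nikodym c (distribution P X).
  by apply/funext => x /=; rewrite fineK// Radon_Nikodym_fin_num.
split; first by rewrite fE; exact: Radon_Nikodym_integrable.
move=> B mB; rewrite -[RHS]/(c B) (Radon_Nikodym_integral c_dom mB).
by apply: eq_integral => x _; rewrite -[LHS]/((EFin \o _) x) fE.
Qed.

End existence.

Lemma cond_prob_at_unique A X (f g : S -> R) :
  is_cond_prob_at A X f -> is_cond_prob_at A X g ->
  {ae distribution P X, forall x, f x = g x}.
Proof.
move=> [fi fB] [gi gB].
have : ae_eq (distribution P X) setT (EFin \o f) (EFin \o g).
  apply: integral_ae_eq => //; first exact: measurable_int gi.
  by move=> B _ mB; rewrite [LHS](fB _ mB) [RHS](gB _ mB).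
by apply: filterS => x /(_ Logic.I) [].
Qed.

End conditioning.

Section laws.
Context {d : measure_display} {T : measurableType d} {R : realType}
  (P : probability T R).
Implicit Type Y : {RV P >-> R}.

Definition degenerate Y : Prop := exists c : R, {ae P, forall w, Y w = c}.

(* meaningful for 0 < t < 1 only *)
Definition quantile Y (t : R) : R := inf [set y : R | (t%:E <= cdf Y y)%E].

End laws.

(* Convergence in distribution of random elements of [E], possibly defined on
   different probability spaces. *)
Definition cvg_in_distribution {R : realType} {E : topologicalType}
    {d_ : nat -> measure_display} {T_ : forall n, measurableType (d_ n)}
    (P_ : forall n, probability (T_ n) R)
    {d : measure_display} {T : measurableType d} (P : probability T R)
    (Z_ : forall n, T_ n -> E) (Z : T -> E) : Prop :=
  forall f : E -> R, continuous f -> (exists M : R, forall z, `|f z| <= M) ->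
    ('E_(P_ n)[f \o Z_ n])%E @[n --> \oo] --> ('E_P[f \o Z])%E.

(* Main.v *)
(* With G(y) = P(Y >= y) and J(y) = P(Y >= y, Y' >= y), conditional
   independence turns the variance of P(Y >= y | X) into J(y) - G(y)^2, so that
   xi(Y, X) is the quotient of the integrals of J - G^2 and G - G^2 against the
   law of Y. Written with the quantile function Q on (0,1), these integrals
   converge by dominated convergence once G_n(Q_n t) -> G(Q t) and
   J_n(Q_n t) -> J(Q t) for almost all t. Weak convergence and the left
   continuity of G give the limsup bounds. For the liminf of G_n(Q_n t): either
   G(Q t) <= 1 - t, and G_n(Q_n t) >= 1 - t always holds; or Q t is an atom,
   1 - G(Q t) < t < F(Q t) (up to countably many t), and for s in
   (1 - G(Q t), t) hypothesis (ii) gives F_n(Q_n s) -> F(Q s) > t, so that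
   eventually Q_n t <= Q_n s and G_n(Q_n t) >= 1 - s. As
   J(z) - J(z') <= 2 (G(z) - G(z')) for z <= z', the liminf bound for J_n(Q_n t)
   follows from the convergence of G_n(Q_n t). *)

Require Import Defs.
From HB Require Import structures.
From mathcomp Require Import all_boot all_order all_algebra.
From mathcomp Require Import all_classical all_reals all_analysis.
From mathcomp Require Import measurable_realfun lra.

Set Implicit Arguments.
Unset Strict Implicit.
Unset Printing Implicit Defensive.

Import Order.TTheory GRing.Theory Num.Theory.
Import numFieldNormedType.Exports.

Local Open Scope classical_set_scope.
Local Open Scope ring_scope.

(** * Conditional probabilities and the variance of P(Y in B | X) *)

Section conditional_probability.
Context {d d' : measure_display} {T : measurableType d} {S : measurableType d'}
  {R : realType} (P : probability T R).
Implicit Types (A : set T) (X : {RV P >-> S}) (Y : {RV P >-> R}).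

Lemma measurable_preimage Y (B : set R) : measurable B -> measurable (Y @^-1` B).
Proof. by move=> mB; rewrite -[X in measurable X]setTI; exact: measurable_funPT. Qed.

Lemma ae_distribution X (Q : S -> Prop) :
  {ae distribution P X, forall x, Q x} -> {ae P, forall w, Q (X w)}.
Proof.
move=> [N [mN N0 QN]]; exists (X @^-1` N); split => //.
- by rewrite -[X in measurable X]setTI; exact: measurable_funPT.
- by move=> w /= QXw; exact: QN.
Qed.

Lemma measurable_cond_prob A X : measurable A ->
  measurable_fun setT (cond_prob A X).
Proof.
move=> mA; have [/measurable_int/measurable_EFinP mf _] := cond_prob_atP mA X.
exact: (measurableT_comp mf).
Qed.

Lemma cond_prob_version A X (f : S -> R) : measurable A ->
  is_cond_prob_at A X f -> {ae P, forall w, cond_prob A X w = f (X w)}.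
Proof.
move=> mA fA; have := cond_prob_at_unique (cond_prob_atP mA X) fA.
exact: ae_distribution.
Qed.

Lemma integrable_cond_prob A X : measurable A ->
  P.-integrable setT (EFin \o cond_prob A X).
Proof.
move=> mA; have [/integrableP[mf foo] _] := cond_prob_atP mA X.
apply/integrableP; split; first exact/measurable_EFinP/measurable_cond_prob.
by move: foo; rewrite ge0_integral_distribution//; exact: measurableT_comp.
Qed.

Lemma expectation_cond_prob A X : measurable A ->
  ('E_P[cond_prob A X] = P A)%E.
Proof.
move=> mA; have [fi fA] := cond_prob_atP mA X.
rewrite unlock -[LHS](@integral_distribution _ _ _ _ _ P X (EFin \o cond_prob_at A X)).
- by rewrite [LHS]fA// preimage_setT setIT.
- exact: measurable_int fi.
- exact: integrable_cond_prob.
Qed.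

Lemma ae_eq_expectation (f g : T -> R) : measurable_fun setT f ->
  measurable_fun setT g -> {ae P, forall w, f w = g w} -> ('E_P[f] = 'E_P[g])%E.
Proof.
move=> mf mg fg; rewrite unlock; apply: ae_eq_integral => //;
  [exact/measurable_EFinP|exact/measurable_EFinP|].
by apply: filterS fg => w /= -> _.
Qed.

Lemma cond_indep_copy_cond_prob Y Y' X (B : set R) : measurable B ->
  cond_indep_copy Y Y' X ->
  {ae P, forall w, cond_prob (Y' @^-1` B) X w = cond_prob (Y @^-1` B) X w}.
Proof.
move=> mB [[k [k' [kY kY' kk']]] _].
have cY := cond_prob_version (measurable_preimage Y mB) (kY B mB).
have cY' := cond_prob_version (measurable_preimage Y' mB) (kY' B mB).
move: cY cY' (ae_distribution kk'); apply: filterS3 => w /= -> -> kk.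
by rewrite kk.
Qed.

Lemma cond_indep_copy_prob Y Y' X (B : set R) : measurable B ->
  cond_indep_copy Y Y' X -> P (Y' @^-1` B) = P (Y @^-1` B).
Proof.
move=> mB YY'; have mY := measurable_preimage Y mB.
have mY' := measurable_preimage Y' mB.
rewrite -(expectation_cond_prob X mY) -(expectation_cond_prob X mY').
apply: ae_eq_expectation; try exact: measurable_cond_prob.
exact: cond_indep_copy_cond_prob.
Qed.

(** Conditional independence and equality of the conditional laws make the square of P(Y in B | X) a
    version of P(Y in B, Y' in B | X), whose mean is the joint probability. *)
Lemma variance_cond_prob Y Y' X (B : set R) : measurable B ->
  cond_indep_copy Y Y' X ->
  ('V_P[cond_prob (Y @^-1` B) X] =
   P (Y @^-1` B `&` Y' @^-1` B) - P (Y @^-1` B) * P (Y @^-1` B))%E.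
Proof.
move=> mB YY'; have mY := measurable_preimage Y mB.
have mY' := measurable_preimage Y' mB.
have mYY' := measurableI _ _ mY mY'.
have mc := measurable_cond_prob X mY.
have ccE : {ae P, forall w, cond_prob (Y @^-1` B `&` Y' @^-1` B) X w =
    (cond_prob (Y @^-1` B) X * cond_prob (Y @^-1` B) X) w}.
  have [_ /(_ B B mB mB)] := YY'.
  move: (cond_indep_copy_cond_prob mB YY').
  by apply: filterS2 => w /= -> ->.
have mcc : measurable_fun setT
    (cond_prob (Y @^-1` B) X * cond_prob (Y @^-1` B) X : T -> R).
  exact: measurable_funM.
rewrite /variance covarianceE ?expectation_cond_prob//.
- congr (_ - _)%E; rewrite -(expectation_cond_prob X mYY'); apply/esym.
  by apply: ae_eq_expectation => //; exact: measurable_cond_prob.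
- exact/Lfun1_integrable/integrable_cond_prob.
- exact/Lfun1_integrable/integrable_cond_prob.
(* The square is integrable because it agrees almost everywhere with the conditional probability of
   the intersection. *)
- apply/Lfun1_integrable; have /integrableP[mi ioo] := integrable_cond_prob X mYY'.
  apply/integrableP; split; first exact/measurable_EFinP.
  rewrite (le_lt_trans _ ioo)// le_eqVlt; apply/orP; left; apply/eqP.
  apply: ae_eq_integral => //.
  + by apply: measurableT_comp => //; exact/measurable_EFinP.
  + exact: measurableT_comp.
  + by apply: filterS ccE => w /= -> _.
Qed.

Lemma variance_indic A : measurable A -> ('V_P[\1_A : T -> R] = P A - P A * P A)%E.
Proof.
move=> mA.
have iA : (\1_A : T -> R) \in Lfun P 1.
  by apply/Lfun1_integrable; exact: integrable_indic.
have AA : (\1_A * \1_A : T -> R) = \1_A.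
  by apply/funext => w /=; rewrite !fctE indicE; case: (w \in A); rewrite ?mulr1 ?mulr0.
by rewrite /variance covarianceE ?AA// expectation_indic.
Qed.

End conditional_probability.

(** * The quantile function and the quantile transform *)

Section quantile.
Context {d : measure_display} {T : measurableType d} {R : realType}
  (P : probability T R) (Y : {RV P >-> R}).

Lemma fin_num_cdf y : cdf Y y \is a fin_num.
Proof. by rewrite fin_num_measure. Qed.

Lemma quantile_has_inf (t : R) : 0 < t < 1 ->
  has_inf [set y : R | (t%:E <= cdf Y y)%E].
Proof.
move=> /andP[t0 t1]; split.
- have : \forall y \near +oo, (t%:E < cdf Y y)%E.
    have t1E : (t%:E < 1)%E by rewrite lte_fin.
    exact: (cvg_cdfy1 Y (open_ereal_gt' t1E)).
  move=> [M [_ MY]]; exists (M + 1) => /=; apply/ltW/MY.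
  by rewrite ltrDl.
- have : \forall y \near -oo, (cdf Y y < t%:E)%E.
    have t0E : (0 < t%:E)%E by rewrite lte_fin.
    exact: (cvg_cdfNy0 Y (open_ereal_lt' t0E)).
  move=> [M [_ MY]]; exists (M - 1) => y /= ty; rewrite leNgt; apply/negP => yM.
  suff : (cdf Y y < t%:E)%E by rewrite ltNge ty.
  by apply: MY; rewrite (lt_le_trans yM)// gerBl.
Qed.

(** Galois connection between quantile and distribution function. The implication from left to right
    needs the infimum to be attained: if F were below [t] at the quantile, right continuity would
    keep it below [t] just to the right, where elements of the set are found. *)
Lemma quantile_le (t y : R) : 0 < t < 1 ->
  (quantile Y t <= y) = (t%:E <= cdf Y y)%E.
Proof.
move=> t01; have iS := quantile_has_inf t01.
apply/idP/idP => [|ty]; last first.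
  by apply: ge_inf => //; exact: iS.2.
move=> qy; apply: le_trans (cdf_nondecreasing Y qy).
rewrite leNgt; apply/negP => /= qt.
have : \forall y \near (quantile Y t)^'+, (cdf Y y < t%:E)%E.
  apply: (@cdf_right_continuous _ _ _ P Y (quantile Y t) [set u | (u < t%:E)%E]).
  exact: open_ereal_lt'.
move=> [e /= e0 eY].
have [s /= ts sq] := inf_adherent e0 iS.
suff : (cdf Y s < t%:E)%E by rewrite ltNge ts.
apply: eY => /=.
- rewrite distrC ger0_norm ?subr_ge0; last by apply: ge_inf => //; exact: iS.2.
  by rewrite ltrBlDl.
- rewrite lt_neqAle ge_inf//; last exact: iS.2.
  by rewrite andbT; apply/negP => /eqP E; move: qt; rewrite E ltNge ts.
Qed.

Lemma lt_quantile (t y : R) : 0 < t < 1 ->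
  (y < quantile Y t) = (cdf Y y < t%:E)%E.
Proof. by move=> t01; rewrite !ltNge quantile_le. Qed.

Lemma le_cdf_quantile (t : R) : 0 < t < 1 -> (t%:E <= cdf Y (quantile Y t))%E.
Proof. by move=> t01; rewrite -quantile_le. Qed.

Lemma quantile_homo (s t : R) : 0 < s < 1 -> 0 < t < 1 -> s <= t ->
  quantile Y s <= quantile Y t.
Proof.
move=> s01 t01 st; rewrite quantile_le// (le_trans _ (le_cdf_quantile t01))//.
Qed.

Lemma measurable_quantile : measurable_fun (`]0, 1[%classic : set R) (quantile Y).
Proof.
apply: (measurability (@RGenOInfty.G R)) => [|/= _ [_] [r] -> <-].
  exact: RGenOInfty.measurableE.
rewrite (_ : _ `&` _ = `]0%R, 1%R[ `&` `]fine (cdf Y r), +oo[)//=; last first.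
  apply/seteqP; split => t /=; rewrite !in_itv/= !andbT => -[t01].
  - by rewrite lt_quantile// -[X in (X < _)%E]fineK ?fin_num_cdf.
  - by rewrite lt_quantile// -[X in _ -> _ /\ (X < _)%E]fineK ?fin_num_cdf.
exact: measurableI.
Qed.

(** The quantile is meaningful on (0,1) only; cutting it off elsewhere gives a measurable map on the
    whole line, as a pushforward requires. *)
Let q := (quantile Y) \_ `]0%R, 1%R[.

Let mq : measurable_fun setT (q : R -> R).
Proof. by apply/(measurable_restrictT _ _).1 => //; exact: measurable_quantile. Qed.

Let nu := mrestr (@lebesgue_measure R)
  (measurable_itv `]0%R, 1%R[ : measurable (`]0%R, 1%R[%classic : set R)).

(** By [lt_quantile], the preimage of []r, +oo[] in (0,1) is []F r, 1[], of length 1 - F(r). These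
    half-lines are stable under intersection and generate the Borel sets, so the two measures
    coincide. *)
Let distribution_quantile (A : set R) : measurable A ->
  distribution P Y A = pushforward nu q A.
Proof.
pose nuq : {measure set R -> \bar R} := pushforward nu q.
have G_itv r : pushforward nu q `]r, +oo[ = distribution P Y `]r, +oo[.
  rewrite /pushforward/= /nu /mrestr -[RHS]/(ccdf Y r) ccdf_1_cdf.
  have F01 : 0 <= fine (cdf Y r) <= 1.
    by rewrite -!lee_fin fineK ?fin_num_cdf// cdf_ge0 cdf_le1.
  rewrite (_ : _ `&` _ = `]fine (cdf Y r), 1[%classic); last first.
    apply/seteqP; split => t /=; rewrite !in_itv/= !andbT.
      move=> [+ t01]; rewrite /q patchE mem_set/= ?in_itv//= lt_quantile//.
      rewrite -[X in (X < _)%E -> _]fineK ?fin_num_cdf// lte_fin => ->.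
      by case/andP : t01.
    move=> /andP[Ft t1]; have t01 : 0 < t < 1.
      by rewrite t1 andbT (le_lt_trans _ Ft)//; case/andP: F01.
    split => //; rewrite /q patchE mem_set/= ?in_itv//= lt_quantile//.
    by rewrite -[X in (X < _)%E]fineK ?fin_num_cdf// lte_fin.
  rewrite lebesgue_measure_itv/= lte_fin -[in RHS](fineK (fin_num_cdf r)).
  case: ifPn => //; rewrite -leNgt => F1.
  have -> : fine (cdf Y r) = 1 by apply/eqP; rewrite eq_le F1 andbT; case/andP : F01.
  by rewrite subee.
move=> mA; apply/esym.
apply: (@measure_unique _ R _ (@RGenOInfty.G R) (fun k => `](- k%:R), +oo[%classic)
  _ _ _ _ (nuq mq) (distribution P Y)) => //.
- exact: RGenOInfty.measurableE.
- move=> _ _ [x ->] [y ->]; exists (Num.max x y).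
  by apply/seteqP; split => z /=; rewrite !in_itv/= !andbT gt_max => /andP.
- by move=> i; exists (- i%:R).
- rewrite -subTset => x _ /=; exists (Num.truncn (- x)).+1 => //=.
  by rewrite in_itv/= andbT ltrNl truncnS_gt.
- by move=> _ [r ->]; exact: G_itv.
- move=> k; rewrite [X in (X < _)%E]G_itv.
  by rewrite (le_lt_trans (probability_le1 _ _))// ltry.
Qed.

Lemma ge0_integral_quantile (f : R -> \bar R) :
  measurable_fun setT f -> (forall y, 0 <= f y)%E ->
  (\int[distribution P Y]_y f y =
   \int[lebesgue_measure]_(t in `]0%R, 1%R[) f (quantile Y t))%E.
Proof.
move=> mf f0.
pose nuq : {measure set R -> \bar R} := pushforward nu q.
rewrite (eq_measure_integral (nuq mq)); last first.
  by move=> A mA _; exact: distribution_quantile.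
rewrite ge0_integral_pushforward// preimage_setT.
have mfq : measurable_fun setT (f \o q) by exact: measurableT_comp.
have mCD : measurable (~` `]0, 1[%classic : set (measurableTypeR R)).
  exact: measurableC.
have mfq' : measurable_fun [set: measurableTypeR R] (f \o q) by exact: mfq.
rewrite (ge0_negligible_integral mCD measurableT mfq'); last 2 first.
- by move=> ? _; exact: f0.
- by rewrite /= /mrestr setICl measure0.
rewrite setTD setCK (eq_measure_integral (@lebesgue_measure R)); last first.
  by move=> A mA AD; rewrite /nu/= /mrestr setIidl.
by apply: eq_integral => t t01; rewrite /= /q patchE t01.
Qed.

End quantile.

(** * Convergence along moving arguments under one-sided bounds *)

Section sandwich.
Context {R : realType}.

(* What weak convergence says about survival functions without mentioning
   continuity points: for z < z', limsup h_n z' <= h z and h z' <= liminf h_n z. *)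
Definition sandwiched (h_ : nat -> R -> R) (h : R -> R) :=
  forall z z' e : R, z < z' -> 0 < e ->
  \forall n \near \oo, h_ n z' <= h z + e /\ h z' - e <= h_ n z.

(** The upper bound compares [j_ n (q_ n)] with values of [j] slightly left of [q], where they are
    close to [j q] because [g] controls the increments of [j]. For the lower bound, [j_ n] loses
    between a point left of [q] and [q_ n] at most twice what [g_ n] loses, which is small by the
    lower bound on [g_ n (q_ n)]. *)
Lemma sandwiched_cvg (g j : R -> R) (g_ j_ : nat -> R -> R) (q : R) (q_ : nat -> R) :
  sandwiched g_ g -> sandwiched j_ j ->
  (forall n z z', z <= z' -> 0 <= j_ n z - j_ n z' <= 2 * (g_ n z - g_ n z')) ->
  (forall z z', z <= z' -> 0 <= j z - j z' <= 2 * (g z - g z')) ->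
  (forall z, z < q -> \forall n \near \oo, z < q_ n) ->
  (forall e, 0 < e -> exists2 z, z < q & g z <= g q + e) ->
  (forall e, 0 < e -> \forall n \near \oo, g q - e <= g_ n (q_ n)) ->
  j_ n (q_ n) @[n --> \oo] --> j q.
Proof.
move=> sg sj jg_ jg lq gq lg; apply/cvgrPdist_le => e0 e0_gt0.
(* The upper estimate costs 3e and the lower one 7e. *)
pose e := e0 / 8; have e_gt0 : 0 < e by rewrite /e; lra.
have [z zq gz] := gq e e_gt0.
(* Each use of [sandwiched] needs two distinct points, hence two intermediate ones. *)
pose z1 := z + (q - z) / 3; pose z2 := z + 2 * (q - z) / 3.
have zz1 : z < z1 by rewrite /z1; lra.
have z12 : z1 < z2 by rewrite /z1 /z2; lra.
have z2q : z2 < q by rewrite /z2; lra.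
near=> n.
have [A1 _] : j_ n z2 <= j z1 + e /\ j z2 - e <= j_ n z1 by near: n; exact: sj.
have [_ A2] : j_ n z2 <= j z1 + e /\ j z2 - e <= j_ n z1 by near: n; exact: sj.
have [A3 _] : g_ n z1 <= g z + e /\ g z1 - e <= g_ n z by near: n; exact: sg.
have A4 : z2 < q_ n by near: n; exact: lq.
have A5 : g q - e <= g_ n (q_ n) by near: n; exact: lg.
have /andP[B1 _] := jg_ n _ _ (ltW A4).
have /andP[_ B2] := jg_ n _ _ (ltW (lt_trans z12 A4)).
have /andP[B3 _] := jg _ _ (ltW zz1).
have /andP[_ B4] := jg _ _ (ltW zq).
have /andP[B5 _] := jg _ _ (ltW z2q).
rewrite ler_distl; apply/andP; split; move: gz A1 A2 A3 A5 B1 B2 B3 B4 B5; rewrite /e; lra.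
Unshelve. all: by end_near. Qed.

End sandwich.

(** * From expectations of continuous functions to probabilities *)

Section portmanteau.
Context {R : realType} {E : topologicalType}.

Lemma expectation_sandwich {d : measure_display} {T : measurableType d}
    (P : probability T R) (Z : T -> E) (A B : set E) (f : E -> R) :
  measurable (Z @^-1` A) -> measurable (Z @^-1` B) ->
  measurable_fun setT (f \o Z) -> (forall x, 0 <= f x <= 1) ->
  (forall x, B x -> f x = 1) -> (forall x, ~ A x -> f x = 0) ->
  (P (Z @^-1` B) <= 'E_P[f \o Z] <= P (Z @^-1` A))%E.
Proof.
move=> mA mB mf f01 fB fA.
rewrite -(expectation_indic P mA) -(expectation_indic P mB).
apply/andP; split; apply: expectation_le => //; try by move=> w; case/andP: (f01 (Z w)).
- apply: aeW => w /=; rewrite indicE.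
  case: (boolP (w \in _)) => [|_]; last by case/andP: (f01 (Z w)).
  by rewrite inE => /= /fB ->.
- apply: aeW => w /=; rewrite indicE.
  case: (boolP (w \in _)) => [_|]; first by case/andP: (f01 (Z w)).
  by rewrite notin_setE => /= /fA ->.
Qed.

(** The continuous [f] separates [B] from the complement of [A], so each of its expectations lies
    between the probabilities of [B] and [A]; convergence of the expectations links the bounds for
    [Z_ n] with those for [Z]. *)
Lemma cvg_in_distribution_sandwich
    {d_ : nat -> measure_display} {T_ : forall n, measurableType (d_ n)}
    (P_ : forall n, probability (T_ n) R)
    {d : measure_display} {T : measurableType d} (P : probability T R)
    (Z_ : forall n, T_ n -> E) (Z : T -> E) (A B : set E) (f : E -> R) (e : R) :
  cvg_in_distribution P_ P Z_ Z ->
  (forall n, measurable (Z_ n @^-1` A)) -> measurable (Z @^-1` A) ->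
  (forall n, measurable (Z_ n @^-1` B)) -> measurable (Z @^-1` B) ->
  (forall n, measurable_fun setT (f \o Z_ n)) -> measurable_fun setT (f \o Z) ->
  continuous f -> (forall x, 0 <= f x <= 1) ->
  (forall x, B x -> f x = 1) -> (forall x, ~ A x -> f x = 0) -> 0 < e ->
  \forall n \near \oo,
    fine (P_ n (Z_ n @^-1` B)) <= fine (P (Z @^-1` A)) + e /\
    fine (P (Z @^-1` B)) - e <= fine (P_ n (Z_ n @^-1` A)).
Proof.
move=> cZ mA_ mA mB_ mB mf_ mf cf f01 fB fA e_gt0.
(* The expectation is finite, being squeezed between two probabilities, so that passing to [fine]
   loses nothing. *)
have fin01 d' (T' : measurableType d') (P' : probability T' R) (Z' : T' -> E) :
    measurable (Z' @^-1` A) -> measurable (Z' @^-1` B) ->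
    measurable_fun setT (f \o Z') ->
    exists2 r : R, ('E_P'[f \o Z'] = r%:E)%E &
      fine (P' (Z' @^-1` B)) <= r <= fine (P' (Z' @^-1` A)).
  move=> mA' mB' mf'.
  have := expectation_sandwich P' mA' mB' mf' f01 fB fA.
  have /fineK EA := fin_num_measure P' _ mA'.
  have /fineK EB := fin_num_measure P' _ mB'.
  case: ('E_P'[_])%E => [r| |].
  - by rewrite -EA -EB !lee_fin => rAB; exists r.
  - by rewrite -EA leye_eq andbF.
  - by rewrite -EB leeNy_eq.
have [r rE /andP[r1 r2]] := fin01 _ _ P Z mA mB mf.
have fM : exists M : R, forall z, `|f z| <= M.
  by exists 1 => z; case/andP: (f01 z) => f0 f1; rewrite ger0_norm.
have := cZ f cf fM; rewrite rE => /fine_cvg /cvgrPdist_le /(_ e e_gt0) /= cr.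
near=> n.
have [rn rnE /andP[rn1 rn2]] := fin01 _ _ (P_ n) (Z_ n) (mA_ n) (mB_ n) (mf_ n).
have : `|r - fine ('E_(P_ n)[f \o Z_ n])%E| <= e by near: n.
rewrite rnE /= ler_distl => /andP[u v].
by split; lra.
Unshelve. all: by end_near. Qed.

End portmanteau.

(** * Piecewise linear test functions *)

Section ramp.
Context {R : realType}.

Definition ramp (z z' x : R) : R := Num.min 1 (Num.max 0 ((x - z) / (z' - z))).

Lemma ramp01 z z' x : 0 <= ramp z z' x <= 1.
Proof. by rewrite /ramp le_min ler01 le_max lexx /= ge_min lexx. Qed.

Lemma ramp1 z z' x : z < z' -> z' <= x -> ramp z z' x = 1.
Proof.
move=> zz' z'x; rewrite /ramp min_l// le_max; apply/orP; right.
by rewrite ler_pdivlMr ?subr_gt0// mul1r lerD2r.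
Qed.

Lemma ramp0 z z' x : z < z' -> x < z -> ramp z z' x = 0.
Proof.
move=> zz' xz; rewrite /ramp (max_l (_ : (x - z) / (z' - z) <= 0)) ?min_r//.
by rewrite pmulr_lle0 ?invr_gt0 ?subr_gt0// subr_le0 ltW.
Qed.

Lemma continuous_ramp z z' : continuous (ramp z z').
Proof.
move=> x; apply: (@continuous_min _ _ (cst 1) (fun x => Num.max 0 ((x - z) / (z' - z)))).
  exact: cst_continuous.
apply: (@continuous_max _ _ (cst 0) (fun x => ((x - z) / (z' - z)))).
  exact: cst_continuous.
apply: cvgM; last exact: cvg_cst.
by apply: cvgB; [exact: cvg_id|exact: cvg_cst].
Qed.

End ramp.

(** * Survival functions P(Y >= y) and P(Y >= y, Y' >= y) *)

Section survival.
Context {d : measure_display} {T : measurableType d} {R : realType}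
  (P : probability T R).
Implicit Type Y : {RV P >-> R}.

Definition survival Y (y : R) : R := fine (P (Y @^-1` `[y, +oo[)).

Definition joint_survival Y Y' (y : R) : R :=
  fine (P (Y @^-1` `[y, +oo[ `&` Y' @^-1` `[y, +oo[)).

Lemma preimage_itvcy Y (y : R) : [set w | (y <= Y w)%R] = Y @^-1` `[y, +oo[.
Proof. by apply/seteqP; split => w /=; rewrite in_itv/= andbT. Qed.

Let mR Y y : measurable (Y @^-1` `[y, +oo[).
Proof. exact: measurable_preimage. Qed.

Let mRR Y Y' y : measurable (Y @^-1` `[y, +oo[ `&` Y' @^-1` `[y, +oo[).
Proof. exact: measurableI. Qed.

Lemma survivalE Y y : ((survival Y y)%:E = P (Y @^-1` `[y, +oo[))%E.
Proof. by rewrite fineK// fin_num_measure. Qed.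

Lemma joint_survivalE Y Y' y : ((joint_survival Y Y' y)%:E =
  P (Y @^-1` `[y, +oo[ `&` Y' @^-1` `[y, +oo[))%E.
Proof. by rewrite fineK// fin_num_measure. Qed.

Lemma survival01 Y y : 0 <= survival Y y <= 1.
Proof. by rewrite -!lee_fin survivalE measure_ge0 probability_le1. Qed.

Lemma joint_survival01 Y Y' y : 0 <= joint_survival Y Y' y <= 1.
Proof. by rewrite -!lee_fin joint_survivalE measure_ge0 probability_le1. Qed.

Let itv_sub (z z' : R) : z <= z' -> `[z', +oo[ `<=` `[z, +oo[%classic.
Proof. by move=> zz'; apply: subset_itvr; rewrite bnd_simp. Qed.

Lemma survival_nonincreasing Y : nonincreasing_fun (survival Y).
Proof.
move=> z z' zz'; rewrite -lee_fin !survivalE le_measure ?inE//.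
by apply: preimage_subset; exact: itv_sub.
Qed.

Lemma joint_survival_nonincreasing Y Y' : nonincreasing_fun (joint_survival Y Y').
Proof.
move=> z z' zz'; rewrite -lee_fin !joint_survivalE le_measure ?inE//.
by apply: setISS; apply: preimage_subset; exact: itv_sub.
Qed.

Lemma survival_ge Y y : 1 - fine (cdf Y y) <= survival Y y.
Proof.
rewrite -lee_fin survivalE EFinB fineK ?fin_num_cdf// -ccdf_1_cdf.
have mO : measurable (Y @^-1` `]y, +oo[) by exact: measurable_preimage.
have mC := mR Y y.
rewrite -[ccdf Y y]/(P (Y @^-1` `]y, +oo[)) le_measure ?inE//.
by apply: preimage_subset; apply: subset_itvr; rewrite bnd_simp.
Qed.

Lemma survival_le Y y z : y < z -> survival Y z <= 1 - fine (cdf Y y).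
Proof.
move=> yz; rewrite -lee_fin survivalE EFinB fineK ?fin_num_cdf// -ccdf_1_cdf.
have mO : measurable (Y @^-1` `]y, +oo[) by exact: measurable_preimage.
have mC := mR Y z.
rewrite -[ccdf Y y]/(P (Y @^-1` `]y, +oo[)) le_measure ?inE//.
by apply: preimage_subset; apply: subset_itvr; rewrite bnd_simp.
Qed.

(** Left continuity, from continuity of the measure along the half-lines starting at y - 1/(n+1),
    which decrease to [[y, +oo[]. *)
Lemma survival_left Y y e : 0 < e -> exists2 z, z < y & survival Y z <= survival Y y + e.
Proof.
move=> e_gt0; pose F n := Y @^-1` `[(y - n.+1%:R^-1)%R, +oo[.
have FE : \bigcap_n F n = Y @^-1` `[y, +oo[.
  rewrite /F -preimage_bigcap; congr (_ @^-1` _).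
  apply/seteqP; split => x /=; last first.
    rewrite in_itv/= andbT => yx n _ /=; rewrite in_itv/= andbT.
    by rewrite (le_trans _ yx)// gerBl invr_ge0.
  move=> Fx; rewrite in_itv/= andbT leNgt; apply/negP => xy.
  have [n] := ltr_add_invr xy; have := Fx n I; rewrite /= in_itv/= andbT.
  by rewrite lerBlDr leNgt => /negP.
have : P (F n) @[n --> \oo] --> P (\bigcap_n F n).
  apply: nonincreasing_cvg_mu.
  - by rewrite -ge0_fin_numE// fin_num_measure//; exact: mR.
  - by move=> n; exact: mR.
  - by apply: bigcap_measurable => // n _; exact: mR.
  - move=> m n mn; apply/subsetPset; apply: preimage_subset; apply: itv_sub.
    by rewrite lerD2l lerN2 lef_pV2 ?posrE// ler_nat.
rewrite FE -survivalE => /fine_cvg /cvgrPdist_le /(_ e e_gt0) [n _ /(_ n (leqnn n))] /=.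
rewrite -/(survival Y _) ler_distl => /andP[h _]; exists (y - n.+1%:R^-1).
  by rewrite gtrBl invr_gt0.
by rewrite -lerBlDr.
Qed.

(** If both variables are at least [z] but not both at least [z'], one of them lies in [[z, z'[];
    these two events have equal probability, whence the factor 2. *)
Lemma joint_survival_diff Y Y' z z' :
  (forall B, measurable B -> P (Y' @^-1` B) = P (Y @^-1` B)) -> z <= z' ->
  0 <= joint_survival Y Y' z - joint_survival Y Y' z' <=
    2 * (survival Y z - survival Y z').
Proof.
move=> YY' zz'; rewrite subr_ge0 joint_survival_nonincreasing//=.
pose I := `[z, z'[%classic : set R.
have mI (X : {RV P >-> R}) : measurable (X @^-1` I) by apply: measurable_preimage; rewrite /I.
have IE : P (Y @^-1` I) = (survival Y z - survival Y z')%:E.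
  have : (survival Y z)%:E = (P (Y @^-1` I) + (survival Y z')%:E)%E.
    rewrite !survivalE -measureU//.
    - congr (P _); rewrite -preimage_setU; congr (_ @^-1` _).
      by rewrite -itv_bndbnd_setU ?bnd_simp.
    - rewrite -preimage_setI -subset0 => w; rewrite /I/= !in_itv/= andbT.
      by move=> [/andP[_ wz]]; rewrite leNgt wz.
  have /fineK <- := fin_num_measure P _ (mI Y).
  by rewrite -EFinD => -[->]; rewrite addrK.
rewrite lerBlDr -lee_fin EFinD joint_survivalE.
have -> : (2 * (survival Y z - survival Y z'))%:E = (P (Y @^-1` I) + P (Y' @^-1` I))%E.
  by rewrite (YY' I (measurable_itv _)) IE -EFinD mulr_natl mulr2n.
rewrite joint_survivalE -addeA.
apply: (@le_trans _ _ (P (Y @^-1` I `|` (Y' @^-1` I `|`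
    (Y @^-1` `[z', +oo[ `&` Y' @^-1` `[z', +oo[)))%E)); last first.
  apply: le_trans (measureU2 _ _ _) _ => //; first by apply: measurableU.
  by rewrite leeD2l// measureU2.
rewrite le_measure ?inE//; first by apply: measurableU => //; exact: measurableU.
move=> w /=; rewrite /I/= !in_itv/= !andbT => -[zY zY'].
rewrite zY zY' /=.
case: (ltP (Y w) z') => [_|_]; first by left.
by right; case: (ltP (Y' w) z') => _; [left|right].
Qed.

(** Every [z] below the quantile has F(z) < t, hence survival at least 1 - t; left continuity
    carries this to the quantile. *)
Lemma quantile_survival Y t : 0 < t < 1 -> 1 - t <= survival Y (quantile Y t).
Proof.
move=> t01; apply/ler_addgt0Pr => e e_gt0.
have [z zq ze] := survival_left Y (quantile Y t) e_gt0.
rewrite (le_trans _ ze)// (le_trans _ (survival_ge Y z))// lerD2l lerN2.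
by rewrite -lee_fin fineK ?fin_num_cdf// ltW// -lt_quantile.
Qed.

Lemma pmf_survival Y y : pmf Y y = survival Y y + fine (cdf Y y) - 1.
Proof.
have m1 : measurable (Y @^-1` [set y]) by exact: measurable_preimage.
have mO : measurable (Y @^-1` `]y, +oo[) by exact: measurable_preimage.
have : survival Y y = pmf Y y + fine (ccdf Y y).
  rewrite /survival /pmf /ccdf -fineD ?fin_num_measure// -measureU//.
  - by rewrite -preimage_setU setU1itv.
  - by rewrite -preimage_setI -subset0 => w /= [->]; rewrite in_itv/= ltxx.
by rewrite ccdf_1_cdf fineB ?fin_num_cdf//= => ->; lra.
Qed.

End survival.

(** * Consequences of the joint convergence in distribution *)

Section joint_convergence.
Context {R : realType}
  {d_ : nat -> measure_display} {T_ : forall n, measurableType (d_ n)}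
  (P_ : forall n, probability (T_ n) R)
  {d : measure_display} {T : measurableType d} (P : probability T R)
  (Y_ Y'_ : forall n, {RV (P_ n) >-> R}) (Y Y' : {RV P >-> R}).
Hypothesis cvgYY' : cvg_in_distribution P_ P
  (fun n w => (Y_ n w, Y'_ n w)) (fun w => (Y w, Y' w)).

Let measurable_ramp_comp d' (T' : measurableType d') (Q : probability T' R)
  (Z : {RV Q >-> R}) z z' : measurable_fun setT (ramp z z' \o Z).
Proof.
apply: measurableT_comp => //; apply: continuous_measurable_fun.
exact: continuous_ramp.
Qed.

Lemma sandwiched_survival : sandwiched (fun n => survival (Y_ n)) (survival Y).
Proof.
move=> z z' e zz' e_gt0.
apply: (cvg_in_distribution_sandwich (f := ramp z z' \o fst)
  (A := fst @^-1` `[z, +oo[) (B := fst @^-1` `[z', +oo[) cvgYY') => //.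
- by move=> n; exact: (measurable_preimage (Y_ n)).
- exact: (measurable_preimage Y).
- by move=> n; exact: (measurable_preimage (Y_ n)).
- exact: (measurable_preimage Y).
- by move=> n; exact: (measurable_ramp_comp (Y_ n)).
- exact: (measurable_ramp_comp Y).
- by move=> x; apply: continuous_comp; [exact: cvg_fst|exact: continuous_ramp].
- by move=> x; exact: ramp01.
- by move=> x /=; rewrite in_itv/= andbT => ?; exact: ramp1.
- by move=> x /=; rewrite in_itv/= andbT => /negP; rewrite -ltNge => ?; exact: ramp0.
Qed.

(** A product of ramps, one per coordinate, separates the two quadrants. *)
Lemma sandwiched_joint_survival :
  sandwiched (fun n => joint_survival (Y_ n) (Y'_ n)) (joint_survival Y Y').
Proof.
move=> z z' e zz' e_gt0.
apply: (cvg_in_distribution_sandwich (f := fun x => ramp z z' x.1 * ramp z z' x.2)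
  (A := fst @^-1` `[z, +oo[ `&` snd @^-1` `[z, +oo[)
  (B := fst @^-1` `[z', +oo[ `&` snd @^-1` `[z', +oo[) cvgYY') => //.
- move=> n; apply: measurableI.
    exact: (measurable_preimage (Y_ n)).
  exact: (measurable_preimage (Y'_ n)).
- apply: measurableI.
    exact: (measurable_preimage Y).
  exact: (measurable_preimage Y').
- move=> n; apply: measurableI.
    exact: (measurable_preimage (Y_ n)).
  exact: (measurable_preimage (Y'_ n)).
- apply: measurableI.
    exact: (measurable_preimage Y).
  exact: (measurable_preimage Y').
- move=> n; apply: measurable_funM.
    exact: (measurable_ramp_comp (Y_ n)).
  exact: (measurable_ramp_comp (Y'_ n)).
- apply: measurable_funM.
    exact: (measurable_ramp_comp Y).
  exact: (measurable_ramp_comp Y').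
- move=> x; apply: cvgM.
    apply: (@continuous_comp _ _ _ fst (ramp z z')); [exact: cvg_fst|exact: continuous_ramp].
  apply: (@continuous_comp _ _ _ snd (ramp z z')); [exact: cvg_snd|exact: continuous_ramp].
- move=> x; have /andP[a0 a1] := ramp01 z z' x.1.
  by have /andP[b0 b1] := ramp01 z z' x.2; rewrite mulr_ge0// mulr_ile1.
- move=> x /= []; rewrite !in_itv/= !andbT => ? ?.
  by rewrite !ramp1// mulr1.
- move=> x /=; rewrite !in_itv/= !andbT => xz.
  have [xz1|xz1] := ltP x.1 z; first by rewrite ramp0// mul0r.
  have [xz2|xz2] := ltP x.2 z; first by rewrite (ramp0 zz' xz2) mulr0.
  by exfalso; apply: xz.
Qed.

(** At a point [z2] between [z] and the quantile one still has F(z2) < t. Half of the gap t - F(z2)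
    is spent on the approximation, which leaves F_n(z) < t eventually. *)
Lemma eventually_lt_quantile t z : 0 < t < 1 -> z < quantile Y t ->
  \forall n \near \oo, z < quantile (Y_ n) t.
Proof.
move=> t01 zq; pose q := quantile Y t.
pose z1 := z + (q - z) / 3; pose z2 := z + 2 * (q - z) / 3.
have zz1 : z < z1 by rewrite /z1 -/q in zq *; lra.
have z12 : z1 < z2 by rewrite /z1 /z2 -/q in zq *; lra.
have z2q : z2 < q by rewrite /z2 -/q in zq *; lra.
have : fine (cdf Y z2) < t.
  by rewrite -lte_fin fineK ?fin_num_cdf// -lt_quantile.
rewrite -subr_gt0 => Ft.
have Gz2 := survival_ge Y z2.
near=> n.
have [_] : survival (Y_ n) z2 <= survival Y z1 + (t - fine (cdf Y z2)) / 2 /\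
    survival Y z2 - (t - fine (cdf Y z2)) / 2 <= survival (Y_ n) z1.
  by near: n; apply: sandwiched_survival => //; rewrite divr_gt0.
have := survival_le (Y_ n) zz1.
rewrite lt_quantile// -[X in _ -> _ -> (X < _)%E]fineK ?fin_num_cdf// lte_fin.
lra.
Unshelve. all: by end_near. Qed.

Lemma liminf_survival_quantile t : 0 < t < 1 ->
  (1 - t < survival Y (quantile Y t) -> t < fine (cdf Y (quantile Y t))) ->
  (forall a b : R, 0 <= a -> a < b -> b <= 1 -> exists2 s, a < s < b &
    cdf (Y_ n) (quantile (Y_ n) s) @[n --> \oo] --> cdf Y (quantile Y s)) ->
  forall e, 0 < e -> \forall n \near \oo,
    survival Y (quantile Y t) - e <= survival (Y_ n) (quantile (Y_ n) t).
Proof.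
move=> t01 tF dense e e_gt0; set g := survival Y (quantile Y t).
have [gt|gt] := leP g (1 - t).
  near=> n; rewrite (le_trans _ (quantile_survival (Y_ n) t01))//.
  by rewrite (le_trans _ gt)// gerBl ltW.
have /andP[g0 g1] : 0 <= g <= 1 := survival01 Y _.
have /andP[t0 t1] := t01.
have a0 : 0 <= 1 - g by rewrite subr_ge0.
(* Of the level [s] to be chosen in this interval, 1 - g < s will give Q t <= Q s, s < t keeps it
   below 1, and s < 1 - g + e makes 1 - s exceed g - e. *)
have ab : 1 - g < Num.min t (1 - g + e).
  by rewrite lt_min ltrBlDr -ltrBlDl gt ltrDl.
have b1 : Num.min t (1 - g + e) <= 1 by rewrite ge_min ltW.
have [s /andP[gs]] := dense _ _ a0 ab b1.
rewrite lt_min => /andP[st se] cs.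
have s01 : 0 < s < 1.
  by rewrite (lt_trans st t1) andbT (le_lt_trans _ gs)// subr_ge0.
(* Otherwise g <= 1 - F(Q s) <= 1 - s, against the choice of [s]. *)
have qts : quantile Y t <= quantile Y s.
  rewrite leNgt; apply/negP => /(survival_le Y); rewrite -/g => gF.
  have := le_cdf_quantile Y s01.
  rewrite -[X in (_ <= X)%E]fineK ?fin_num_cdf// lee_fin.
  lra.
have tFs : (t%:E < cdf Y (quantile Y s))%E.
  rewrite (lt_le_trans _ (cdf_nondecreasing Y qts))//.
  by rewrite -[X in (_ < X)%E]fineK ?fin_num_cdf// lte_fin tF.
have : \forall n \near \oo, (t%:E < cdf (Y_ n) (quantile (Y_ n) s))%E.
  exact: (cs _ (open_ereal_gt' tFs)).
apply: filterS => n tFn.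
have qn : quantile (Y_ n) t <= quantile (Y_ n) s by rewrite quantile_le// ltW.
rewrite (le_trans _ (survival_nonincreasing (Y_ n) qn))//.
by rewrite (le_trans _ (quantile_survival (Y_ n) s01))//; lra.
Unshelve. all: by end_near. Qed.

End joint_convergence.

(** * Exceptional levels of measure zero *)

Section almost_everywhere.
Context {R : realType}.
Local Notation mu := (@lebesgue_measure R).

Lemma ae_lebesgueS (Q Q' : R -> Prop) : (forall t, Q t -> Q' t) ->
  {ae mu, forall t, Q t} -> {ae mu, forall t, Q' t}.
Proof. exact: (@filterS _ _ (ae_filter_ringOfSetsType mu)). Qed.

(** A null set contains no interval of positive length. *)
Lemma ae_exists_itv (Q : R -> Prop) : {ae mu, forall t, 0 < t < 1 -> Q t} ->
  forall a b : R, 0 <= a -> a < b -> b <= 1 -> exists2 s, a < s < b & Q s.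
Proof.
move=> [N [mN N0 QN]] a b a0 ab b1; apply: contrapT => nQ.
have abN : `]a, b[ `<=` N.
  move=> s /=; rewrite in_itv/= => asb; apply: QN => /= Qs.
  apply: nQ; exists s => //; apply: Qs; move: asb => /andP[as_ sb].
  by rewrite (le_lt_trans a0 as_) (lt_le_trans sb b1).
have : (mu `]a, b[ <= mu N)%E by rewrite le_measure ?inE.
by rewrite N0 lebesgue_measure_itv/= lte_fin ab lee_fin subr_le0 leNgt ab.
Qed.

(** At an exceptional [t], F(Q t) = t, and then 1 - t < G(Q t) says that Q t is an atom. So [t] is
    the value of F at one of the countably many atoms. *)
Lemma ae_quantile_jump {d : measure_display} {T : measurableType d}
    (P : probability T R) (Y : {RV P >-> R}) :
  {ae mu, forall t, 0 < t < 1 ->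
    1 - t < survival Y (quantile Y t) -> t < fine (cdf Y (quantile Y t))}.
Proof.
pose N := (fine \o cdf Y) @` [set r | 0 < pmf Y r].
have cN : countable N.
  exact/(sub_countable (card_image_le _ _))/pmf_gt0_countable.
exists N; split.
- exact: countable_measurable.
- exact: countable_lebesgue_measure0.
- move=> t /= /not_implyP[t01 /not_implyP[Gt /negP]]; rewrite -leNgt => Ft.
  exists (quantile Y t) => /=; last first.
    apply/eqP; rewrite eq_le Ft/= -lee_fin fineK ?fin_num_cdf//.
    exact: le_cdf_quantile.
  rewrite pmf_survival; have := le_cdf_quantile Y t01.
  by rewrite -[X in (_ <= X)%E]fineK ?fin_num_cdf// lee_fin; lra.
Qed.

End almost_everywhere.

(** * Convergence of the survival functions at the quantiles and of integrals *)

Section convergence.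
Context {R : realType}
  {d_ : nat -> measure_display} {T_ : forall n, measurableType (d_ n)}
  (P_ : forall n, probability (T_ n) R)
  {d : measure_display} {T : measurableType d} (P : probability T R)
  (Y_ Y'_ : forall n, {RV (P_ n) >-> R}) (Y Y' : {RV P >-> R}).
Hypothesis cvgYY' : cvg_in_distribution P_ P
  (fun n w => (Y_ n w, Y'_ n w)) (fun w => (Y w, Y' w)).
Hypothesis cvgFQ : {ae lebesgue_measure, forall t : R, 0 < t < 1 ->
  cdf (Y_ n) (quantile (Y_ n) t) @[n --> \oo] --> cdf Y (quantile Y t)}.
Hypothesis lawY'_ : forall n B, measurable B ->
  P_ n (Y'_ n @^-1` B) = P_ n (Y_ n @^-1` B).
Hypothesis lawY' : forall B, measurable B -> P (Y' @^-1` B) = P (Y @^-1` B).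

Lemma ae_cvg_survival_quantile : {ae lebesgue_measure, forall t : R, 0 < t < 1 ->
  survival (Y_ n) (quantile (Y_ n) t) @[n --> \oo] --> survival Y (quantile Y t) /\
  joint_survival (Y_ n) (Y'_ n) (quantile (Y_ n) t) @[n --> \oo] -->
    joint_survival Y Y' (quantile Y t)}.
Proof.
have := ae_quantile_jump Y; apply: ae_lebesgueS => t jump t01.
have dense := ae_exists_itv cvgFQ.
have liminfG := liminf_survival_quantile t01 (jump t01) dense.
have G_left := survival_left Y (quantile Y t).
have ltq z := @eventually_lt_quantile _ _ _ _ _ _ _ _ _ _ _ cvgYY' t z t01.
have sG := sandwiched_survival cvgYY'.
have G2 d' (T' : measurableType d') (Q : probability T' R) (Z : {RV Q >-> R}) z z' :
    z <= z' ->
    0 <= survival Z z - survival Z z' <= 2 * (survival Z z - survival Z z').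
  move=> zz'; have := survival_nonincreasing Z zz'; rewrite -subr_ge0 => ?.
  by apply/andP; split => //; lra.
split.
(* The survival function serves here as both [g] and [j]; the second conjunct takes the joint
   survival as [j]. *)
- apply: (sandwiched_cvg sG sG) => //.
  + by move=> n z z'; exact: G2.
  + by move=> z z'; exact: G2.
- apply: (sandwiched_cvg sG (sandwiched_joint_survival cvgYY')) => //.
  + by move=> n z z'; apply: joint_survival_diff; exact: lawY'_.
  + by move=> z z'; exact: joint_survival_diff.
Qed.

(** The quantile transform moves the integrals against varying laws to the one space (0,1), where
    dominated convergence applies with bound 1. *)
Lemma cvg_integral_quantile (c_ : nat -> R -> R) (c : R -> R) :
  (forall n, measurable_fun setT (c_ n)) -> measurable_fun setT c ->
  (forall n y, 0 <= c_ n y <= 1) -> (forall y, 0 <= c y <= 1) ->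
  {ae lebesgue_measure, forall t : R, 0 < t < 1 ->
    c_ n (quantile (Y_ n) t) @[n --> \oo] --> c (quantile Y t)} ->
  fine (\int[distribution (P_ n) (Y_ n)]_y (c_ n y)%:E)%E @[n --> \oo] -->
  fine (\int[distribution P Y]_y (c y)%:E)%E.
Proof.
move=> mc_ mc c_01 c01 cc.
have intE d' (T' : measurableType d') (Q : probability T' R) (Z : {RV Q >-> R})
    (f : R -> R) : measurable_fun setT f -> (forall y, 0 <= f y <= 1) ->
    (\int[distribution Q Z]_y (f y)%:E =
     \int[lebesgue_measure]_(t in `]0%R, 1%R[) (f (quantile Z t))%:E)%E.
  move=> mf f01; rewrite (@ge0_integral_quantile _ _ _ _ _ (EFin \o f))//.
    exact/measurable_EFinP.
  by move=> y; rewrite lee_fin; case/andP: (f01 y).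
under eq_fun do rewrite intE//.
rewrite intE//.
have m01 : measurable (`]0, 1[%classic : set (measurableTypeR R)).
  exact: measurable_itv.
have i1 : lebesgue_measure.-integrable
    (`]0, 1[%classic : set (measurableTypeR R)) (EFin \o cst (1:R)).
  apply: measurable_bounded_integrable => //.
  - by rewrite /= lebesgue_measure_itv/= lte_fin ltr01 -EFinB ltry.
  - exact: bounded_cst.
have mcq d' (T' : measurableType d') (Q : probability T' R) (Z : {RV Q >-> R})
    (f : R -> R) : measurable_fun setT f ->
    measurable_fun (`]0, 1[%classic : set (measurableTypeR R))
      (fun t => (f (quantile Z t))%:E).
  move=> mf; apply/measurable_EFinP; apply: (measurableT_comp mf).
  exact: measurable_quantile.
have [] := @dominated_convergence _ _ _ lebesgue_measure _ m01
  (fun n t => (c_ n (quantile (Y_ n) t))%:E) (fun t => (c (quantile Y t))%:E)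
  (EFin \o cst 1).
- by move=> n; exact: mcq.
- exact: mcq.
- apply: (ae_lebesgueS _ cc) => t ct /=; rewrite in_itv/= => /ct h.
  by apply: cvg_EFin h; exact: nearW.
- exact: i1.
- apply: aeW => t n _ /=; rewrite lee_fin.
  by have /andP[c0 c1] := c_01 n (quantile (Y_ n) t); rewrite ger0_norm.
- move=> ci _ h; apply: fine_cvg; rewrite fineK//.
  exact: integrable_fin_num.
Qed.

End convergence.

(** * The rank correlation in terms of survival functions *)

Section chatterjee.
Context {d d' : measure_display} {T : measurableType d} {S : measurableType d'}
  {R : realType} (P : probability T R).
Implicit Types (X : {RV P >-> S}) (Y : {RV P >-> R}).

Lemma variance_cond_survival Y Y' X y : cond_indep_copy Y Y' X ->
  ('V_P[cond_prob [set w | (y <= Y w)%R] X] =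
   (joint_survival Y Y' y - survival Y y ^+ 2)%:E)%E.
Proof.
move=> YY'; rewrite preimage_itvcy (@variance_cond_prob _ _ _ _ _ _ Y Y')//.
by rewrite EFinB expr2 EFinM joint_survivalE !survivalE.
Qed.

Lemma variance_indic_survival Y y :
  ('V_P[(\1_[set w | (y <= Y w)%R] : T -> R)] =
   (survival Y y - survival Y y ^+ 2)%:E)%E.
Proof.
rewrite preimage_itvcy variance_indic; last exact: measurable_preimage.
by rewrite EFinB expr2 EFinM !survivalE.
Qed.

(** The lower bound holds because the expression is a variance. *)
Lemma cond_survival_variance01 Y Y' X y : cond_indep_copy Y Y' X ->
  0 <= joint_survival Y Y' y - survival Y y ^+ 2 <= 1.
Proof.
move=> YY'; rewrite -lee_fin -(variance_cond_survival y YY') variance_ge0/=.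
have /andP[_ J1] := joint_survival01 Y Y' y.
by rewrite lerBlDr (le_trans J1)// lerDl sqr_ge0.
Qed.

Lemma survival_variance01 Y y : 0 <= survival Y y - survival Y y ^+ 2 <= 1.
Proof.
have /andP[G0 G1] := survival01 Y y.
rewrite subr_ge0 expr2 ler_piMl//=.
by rewrite lerBlDr (le_trans G1)// lerDl mulr_ge0.
Qed.

Lemma chatterjee_xiE Y Y' X : cond_indep_copy Y Y' X ->
  chatterjee_xi Y X =
  fine (\int[distribution P Y]_y (joint_survival Y Y' y - survival Y y ^+ 2)%:E)%E /
  fine (\int[distribution P Y]_y (survival Y y - survival Y y ^+ 2)%:E)%E.
Proof.
move=> YY'; rewrite /chatterjee_xi; congr (fine _ / fine _).
- by apply: eq_integral => y _; exact: variance_cond_survival.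
- by apply: eq_integral => y _; exact: variance_indic_survival.
Qed.

Lemma measurable_survival Y : measurable_fun setT (survival Y).
Proof. by apply: nonincreasing_measurable => //; exact: survival_nonincreasing. Qed.

Lemma measurable_joint_survival Y Y' : measurable_fun setT (joint_survival Y Y').
Proof.
by apply: nonincreasing_measurable => //; exact: joint_survival_nonincreasing.
Qed.

Lemma measurable_survival_variance Y :
  measurable_fun setT (fun y => survival Y y - survival Y y ^+ 2).
Proof.
by apply: measurable_funB; [|apply: measurable_funX]; exact: measurable_survival.
Qed.

Lemma measurable_cond_survival_variance Y Y' :
  measurable_fun setT (fun y => joint_survival Y Y' y - survival Y y ^+ 2).
Proof.
apply: measurable_funB; first exact: measurable_joint_survival.
by apply: measurable_funX; exact: measurable_survival.
Qed.

(* [survival Y z <= 1 - s] as soon as [quantile Y s < z], hence the quantile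
   function is constant. *)
Lemma survival_quantile_degenerate Y :
  (forall t, 0 < t < 1 -> survival Y (quantile Y t) = 1) -> degenerate Y.
Proof.
move=> G1.
have h01 : 0 < (2^-1 : R) < 1 by apply/andP; split; lra.
pose c := quantile Y 2^-1.
(* A quantile above the median [c] would have survival at most 1 - F(c) <= 1/2. *)
have qc t : 0 < t < 1 -> quantile Y t <= c.
  move=> t01; rewrite leNgt; apply/negP => /(survival_le Y); rewrite G1//.
  have := le_cdf_quantile Y h01.
  rewrite -/c -[X in (_ <= X)%E]fineK ?fin_num_cdf// lee_fin.
  by case/andP: h01 => ? _; lra.
have Fc : fine (cdf Y c) = 1.
  apply/eqP; rewrite eq_le; apply/andP; split.
    by rewrite -lee_fin fineK ?fin_num_cdf// cdf_le1.
  rewrite leNgt; apply/negP => Fc1.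
  have F0 : 0 <= fine (cdf Y c) by rewrite -lee_fin fineK ?fin_num_cdf// cdf_ge0.
  (* A level strictly between F(c) and 1: its quantile is at most [c], so t <= F(c), a
     contradiction. *)
  pose t := (fine (cdf Y c) + 1) / 2.
  have t01 : 0 < t < 1 by apply/andP; split; rewrite /t; lra.
  have := qc t t01.
  rewrite quantile_le// -[X in (_ <= X)%E]fineK ?fin_num_cdf// lee_fin.
  by rewrite /t; lra.
have mc : measurable (Y @^-1` [set c]) by exact: measurable_preimage.
have pc : P (Y @^-1` [set c]) = 1%E.
  have := pmf_survival Y c; rewrite /pmf Fc (G1 _ h01) => pE.
  rewrite -[LHS]fineK ?fin_num_measure//.
  by rewrite pE; congr (_%:E); lra.
exists c; exists (~` (Y @^-1` [set c])); split => //.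
- exact: measurableC.
- by rewrite probability_setC ?pc ?subee.
Qed.

(** If the integral of G(1 - G) vanishes, then G(Q t) is 0 or 1 for almost all [t]; the value 0 is
    excluded by G(Q t) >= 1 - t, and G = 1 at all quantiles forces degeneracy. *)
Lemma integral_survival_variance_neq0 Y : ~ degenerate Y ->
  fine (\int[distribution P Y]_y (survival Y y - survival Y y ^+ 2)%:E)%E != 0.
Proof.
move=> ndY; apply/eqP => int0; apply: ndY.
pose v y := survival Y y - survival Y y ^+ 2.
have v0 y : 0 <= v y by case/andP: (survival_variance01 Y y).
have m01 : measurable (`]0, 1[%classic : set (measurableTypeR R)).
  exact: measurable_itv.
have mv : measurable_fun setT (EFin \o v).
  by apply/measurable_EFinP; exact: (measurable_survival_variance Y).
have mvq : measurable_fun (`]0, 1[%classic : set (measurableTypeR R)) 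
    (EFin \o v \o quantile Y).
  by apply: (measurableT_comp mv); exact: measurable_quantile.
have intv : (\int[distribution P Y]_y (EFin \o v) y =
    \int[lebesgue_measure]_(t in `]0%R, 1%R[) (EFin \o v) (quantile Y t))%E.
  by apply: ge0_integral_quantile => // y; rewrite lee_fin.
have {}int0 : (\int[distribution P Y]_y (EFin \o v) y = 0)%E.
  (* [fine] also sends infinite values to 0, so the integral is first shown finite: its integrand is
     at most 1. *)
  move/eqP: int0; rewrite fine_eq0; last first.
    rewrite ge0_fin_numE; last by apply: integral_ge0 => y _; rewrite lee_fin; exact: v0.
    apply: (@le_lt_trans _ _ (\int[distribution P Y]_y (cst 1%E) y)%E).
      apply: ge0_le_integral => //.
      - by move=> y _; rewrite lee_fin; exact: v0.
      - by move=> y _ /=; rewrite lee_fin; case/andP: (survival_variance01 Y y).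
    rewrite integral_cst// mul1e.
    exact: (le_lt_trans (probability_le1 (distribution P Y) measurableT) (ltry _)).
  by move/eqP.
have vq0 : {ae lebesgue_measure, forall t : R, 0 < t < 1 -> v (quantile Y t) = 0}.
  have := (ae_eq_integral_abs lebesgue_measure m01 mvq).1.
  move=> h.
  have : (\int[lebesgue_measure]_(t in `]0%R, 1%R[)
      `|(EFin \o v \o quantile Y) t| = 0)%E.
    rewrite -[RHS]int0 intv; apply: eq_integral => t _ /=.
    by rewrite ger0_norm.
  move=> /h; apply: ae_lebesgueS => t /= vt t01.
  by have [] : (v (quantile Y t))%:E = 0%:E by apply: vt; rewrite in_itv.
(* From almost all levels to all: some good [s] lies above [t], and survival decreases along the
   quantiles. *)
have G1 t : 0 < t < 1 -> survival Y (quantile Y t) = 1.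
  move=> /andP[t0 t1].
  have [s /andP[ts s1] vs] := ae_exists_itv vq0 (ltW t0) t1 (lexx 1).
  have s01 : 0 < s < 1 by rewrite s1 andbT (lt_trans t0).
  have Gs := quantile_survival Y s01.
  have Gs1 : survival Y (quantile Y s) = 1.
    move/eqP: vs; rewrite /v expr2 -{1}[survival _ _]mulr1 -mulrBr mulf_eq0.
    have /gt_eqF -> : 0 < survival Y (quantile Y s) by rewrite (lt_le_trans _ Gs)// subr_gt0.
    by rewrite /= subr_eq0 => /eqP.
  apply/eqP; rewrite eq_le; apply/andP; split.
    by case/andP: (survival01 Y (quantile Y t)).
  rewrite -Gs1; apply: survival_nonincreasing.
  by apply: quantile_homo => //; [rewrite t0|exact: ltW].
exact: survival_quantile_degenerate.
Qed.

End chatterjee.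

Theorem theorem2p2 (R : realType)
  (d_ : nat -> measure_display) (T_ : forall n : nat, measurableType (d_ n))
  (P_ : forall n : nat, probability (T_ n) R)
  (d : measure_display) (T : measurableType d) (P : probability T R)
  (p_ : nat -> nat) (p : nat)
  (Y_ Y'_ : forall n : nat, {RV (P_ n) >-> R})
  (X_ : forall n : nat, {RV (P_ n) >-> (p_ n).-tuple R})
  (Y Y' : {RV P >-> R}) (X : {RV P >-> p.-tuple R})
  (ndY_ : forall n : nat, ~ degenerate (Y_ n)) (ndY : ~ degenerate Y)
  (copy_ : forall n : nat, cond_indep_copy (Y_ n) (Y'_ n) (X_ n))
  (copy : cond_indep_copy Y Y' X)
  (cvgYY' : cvg_in_distribution P_ P
     (fun n w => (Y_ n w, Y'_ n w)) (fun w => (Y w, Y' w)))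
  (cvgFQ : {ae lebesgue_measure, forall t : R, 0 < t < 1 ->
     cdf (Y_ n) (quantile (Y_ n) t) @[n --> \oo] --> cdf Y (quantile Y t)}) :
  chatterjee_xi (Y_ n) (X_ n) @[n --> \oo] --> chatterjee_xi Y X.
Proof.
have lawY'_ n B : measurable B -> P_ n (Y'_ n @^-1` B) = P_ n (Y_ n @^-1` B).
  by move=> mB; exact: cond_indep_copy_prob (copy_ n).
have lawY' B : measurable B -> P (Y' @^-1` B) = P (Y @^-1` B).
  by move=> mB; exact: cond_indep_copy_prob copy.
have cvgGJ := ae_cvg_survival_quantile cvgYY' cvgFQ lawY'_ lawY'.
rewrite (chatterjee_xiE copy).
under eq_fun do rewrite (chatterjee_xiE (copy_ _)).
(* Numerator and denominator converge separately; non-degeneracy of [Y] keeps the limit of the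
   denominator away from 0. *)
apply: cvgM; last apply: cvgV.
- apply: cvg_integral_quantile.
  + by move=> n; exact: measurable_cond_survival_variance.
  + exact: measurable_cond_survival_variance.
  + by move=> n y; exact: cond_survival_variance01 (copy_ n).
  + by move=> y; exact: cond_survival_variance01 copy.
  + move: cvgGJ; apply: ae_lebesgueS => t GJ /GJ[G J]; apply: cvgB => //.
    by under eq_fun do rewrite expr2; rewrite expr2; exact: cvgM.
- exact: integral_survival_variance_neq0.
- apply: cvg_integral_quantile.
  + by move=> n; exact: measurable_survival_variance.
  + exact: measurable_survival_variance.
  + by move=> n y; exact: survival_variance01.
  + by move=> y; exact: survival_variance01.
  + move: cvgGJ; apply: ae_lebesgueS => t GJ /GJ[G J]; apply: cvgB => //.
    by under eq_fun do rewrite expr2; rewrite expr2; exact: cvgM.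
Qed.
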